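(* Let $m\ge 0$ be an integer and let $A_1,\dots,A_n,B_1,\dots,B_n$ be subsets of some universe satisfying $A_i\cap B_i=\varnothing$ and $|A_i|+|B_i|\le m$ for every $i\in[n]$. Suppose $n>\binom{m}{\lfloor m/2\rfloor}$ and set $k := n-\binom{m}{\lfloor m/2\rfloor}$. Then for every $q\in[n]$, $$\Pr_{Q\leftarrow\binom{[n]}{q}}\big[\exists i\in Q\ \ \exists j\in[n]\setminus Q:\ A_i\cap B_j\subseteq B_i\big]\ \ge\ 1-\prod_{i=0}^{k}\frac{n-q-i}{n-i}-\frac{q}{n}\ \ge\ 1-\exp\!\Big(-\frac{q(k+1)}{n}\Big)-\frac{q}{n}.$$
   Context: $[n]=\{1,\dots,n\}$, $\binom{[n]}{q}$ is the set of subsets of $[n]$ of size $q$, and $Q\leftarrow\binom{[n]}{q}$ means that $Q$ is uniformly distributed on $\binom{[n]}{q}$. *)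

(* Defs.v *)
From mathcomp Require Import all_boot all_order all_algebra.
From mathcomp Require Import reals.
Set Implicit Arguments.
Unset Strict Implicit.
Unset Printing Implicit Defensive.
Import Order.TTheory GRing.Theory Num.Theory.
Local Open Scope ring_scope.

Definition qsubsets (n q : nat) : {set {set 'I_n}} :=
  [set Q : {set 'I_n} | #|Q| == q].

(* The probability of [E] when [X] is uniformly distributed on [S]; it is only
   meaningful for nonempty [S] (it is 0 when [S] is empty). *)
Definition unifPr (R : realType) (T : finType) (S : {set T}) (E : pred T) : R :=
  #|[set X in S | E X]|%:R / #|S|%:R.

(* Main.v *)
(** Write i -> j when i <> j and A i misses B j.  By Bollobas' inequality a set of
    indices without arrows has at most C(m, m/2) elements, so at least k indices
    have an out-neighbour; let D be a set of k of them, f i an out-neighbour of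
    i, and r an index outside D.  If no arrow leaves Q (Q is bad) then f maps
    Q :&: D into Q.  The star, where f is constantly r, is the worst case: there
    badness means that r lies in Q or that Q misses the k + 1 points of r |: D,
    which gives the bound.  To compare with the star, expose D in a fixed order
    up to the first i in Q; the out-neighbour f i must then lie in Q, so it is
    not yet exposed, and exchanging it with r is injective. *)
Require Import Defs.
From mathcomp Require Import all_boot all_order all_algebra finmap.
From mathcomp Require Import reals sequences exp.
From mathcomp Require Import fingroup perm.
From mathcomp Require Import ring lra zify.
Set Implicit Arguments.
Unset Strict Implicit.
Unset Printing Implicit Defensive.
Import Order.TTheory GRing.Theory Num.Theory.
Local Open Scope ring_scope.

Lemma leq_bin_half m a : ('C(m, a) <= 'C(m, m./2))%N.
Proof.
have up d b : (b + d = m./2)%N -> ('C(m, b) <= 'C(m, m./2))%N.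
  elim: d b => [|d IHd] b; first by rewrite addn0 => ->.
  rewrite addnS -addSn => eb; apply: leq_trans (IHd _ eb).
  have b1_le : (b.+1 <= m - b)%N by lia.
  rewrite -(leq_pmul2l (ltn0Sn b)) mul_bin_left.
  by rewrite leq_mul2r b1_le orbT.
have [a_le|a_gt] := leqP a m./2; first by apply: (up (m./2 - a)%N); lia.
have [a_lem|m_lta] := leqP a m; last by rewrite bin_small.
by rewrite -bin_sub //; apply: (up (m./2 - (m - a))%N); lia.
Qed.

Lemma sum_mem_fset (R : pzSemiRingType) (U : choiceType) (A X : {fset U}) :
  (A `<=` X)%fset -> \sum_(x <- X) (x \in A)%:R = #|` A|%:R :> R.
Proof.
move=> AX; rewrite -natr_sum; congr _%:R.
rewrite -big_mkcond /= sum1_count -size_filter.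
apply/perm_size/uniq_perm; rewrite ?filter_uniq ?fset_uniq // => x.
by rewrite mem_filter andb_idr // => /(fsubsetP AX).
Qed.
(** The balance equation behind [bollobas_sum]: deleting a point from [B i] multiplies the weight of
    the pair by [(a + b) / b]. *)
Lemma binV_pred (R : numFieldType) (a b : nat) : (0 < b)%N ->
  b%:R * ('C(a + b.-1, a)%:R)^-1 = (a + b)%:R * ('C(a + b, a)%:R)^-1 :> R.
Proof.
case: b => // b _; rewrite -[b.+1.-1]/b.
have := mul_bin_down (a + b.+1) a; rewrite addnS /= -addnS addKn.
move=> /(congr1 (fun n => n%:R : R)); rewrite !natrM => e.
have c0 : 'C(a + b, a)%:R != 0 :> R by rewrite pnatr_eq0 -lt0n bin_gt0 leq_addr.
have c1 : 'C(a + b.+1, a)%:R != 0 :> R by rewrite pnatr_eq0 -lt0n bin_gt0 leq_addr.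
by apply/eqP; rewrite eqr_div // e.
Qed.

(** For [q <= n] the product is the probability that a uniform [q]-subset of [n] points misses [j]
    given ones, exposed one at a time. *)
Lemma prodr_bin (R : numFieldType) (n q j : nat) : (j <= n)%N ->
  \prod_(0 <= i < j) ((n%:R - q%:R - i%:R) / (n%:R - i%:R))
    * 'C(n, q)%:R = 'C(n - j, q)%:R :> R.
Proof.
elim: j => [|j IHj] jn; first by rewrite big_nil mul1r subn0.
rewrite big_nat_recr //= mulrAC (IHj (ltnW jn)) subnS.
have N0 : (n%:R - j%:R : R) != 0.
  by rewrite -natrB ?(ltnW jn) // pnatr_eq0 subn_eq0 -ltnNge.
apply: (mulfI N0); rewrite mulrCA [_ * (_ / _)]mulrC divfK //.
rewrite -[in RHS]natrB ?(ltnW jn) // -natrM mul_bin_down natrM mulrC.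
have [qle|qgt] := leqP q (n - j); last by rewrite bin_small // !mulr0.
by rewrite natrB // natrB ?(ltnW jn) // addrAC.
Qed.
(* Induction on the universe X: apply the inequality to the pairs
   (A i, B i `\ x) with x \notin A i and sum over x in X.  Each pair then
   contributes #|X| times its own weight, provided that B i is nonempty; an
   empty B i forces S = [set i]. *)
Lemma bollobas_sum (R : realFieldType) (U : choiceType) (I : finType)
    (X : {fset U}) (S : {set I}) (A B : I -> {fset U}) :
  {in S, forall i, (A i `<=` X)%fset} ->
  {in S, forall i, (B i `<=` X)%fset} ->
  {in S, forall i, (A i `&` B i = fset0)%fset} ->
  {in S &, forall i j, i != j -> (A i `&` B j)%fset != fset0} ->
  \sum_(i in S) ('C(#|` A i| + #|` B i|, #|` A i|)%:R)^-1 <= 1 :> R.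
Proof.
have [N] := ubnP #|` X|; elim: N => // N IH in X S B *; rewrite ltnS => XN AX BX AB cross.
pose w a b : R := ('C(a + b, a)%:R)^-1.
have [[i iS Bi0]|noB0] : {i | i \in S & B i = fset0} + {in S, forall i, (0 < #|` B i|)%N}.
  case: (pickP (fun i => (i \in S) && (B i == fset0))) => [i /andP[iS /eqP Bi]|no].
    by left; exists i.
  by right=> i iS; rewrite cardfs_gt0; have:= no i; rewrite iS /= => ->.
  have S1 : S = [set i].
    apply/setP => j; rewrite inE; apply/idP/eqP => [jS|-> //].
    apply/eqP; apply: contraT => ji; have := cross j i jS iS ji.
    by rewrite Bi0 fsetI0 eqxx.
  by rewrite S1 big_set1 Bi0 cardfs0 addn0 binn invr1.
have [X0|X0] := posnP #|` X|.
  rewrite big1 // => i iS; have := noB0 i iS.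
  by rewrite lt0n -leqn0 -X0 (fsubset_leq_card (BX i iS)).
have NX : 0 < #|` X|%:R :> R by rewrite ltr0n.
rewrite -(ler_pM2l NX) mulr1 mulr_sumr.
suff -> : \sum_(i in S) #|` X|%:R * w #|` A i| #|` B i| =
   \sum_(x <- X) \sum_(i in S | x \notin A i) w #|` A i| #|` (B i `\ x)%fset|.
  rewrite -[leRHS](sum_mem_fset R (fsubset_refl X)) big_seq [leRHS]big_seq.
  apply: ler_sum => x xX; rewrite xX.
  pose S' := [set i in S | x \notin A i].
  under eq_bigl => i do rewrite -[_ && _](in_set (fun i => (i \in S) && (x \notin A i))).
  apply: (IH (X `\ x)%fset).
  - by move: XN; rewrite (cardfsD1 x X) xX.
  - by move=> i; rewrite inE => /andP[iS xA]; rewrite fsubsetD1 AX.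
  - by move=> i; rewrite inE => /andP[iS xA]; rewrite fsetSD // BX.
  - by move=> i; rewrite inE => /andP[iS xA]; rewrite fsetIDA AB // fset0D.
  (* If deleting [x] emptied the intersection, [A i] and [B j] would meet in [x] alone, but [x] is
     not in [A i]. *)
  move=> i j; rewrite !inE => /andP[iS xA] /andP[jS _] /(cross i j iS jS).
  apply: contraNneq; rewrite fsetIDA => /eqP; rewrite fsetD_eq0 => /fsubsetP sub.
  apply/eqP/fsetP => y; rewrite [RHS]in_fset0; apply/negP => yAB; have := sub y yAB.
  by rewrite in_fset1 => /eqP e; move: yAB; rewrite in_fsetI e (negPf xA).
under [RHS]eq_bigr do rewrite big_mkcondr.
rewrite exchange_big; apply: eq_bigr => i iS /=.
(* With [a], [b] the sizes of [A i], [B i]: a point of [A i] contributes nothing, one of [B i]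
   contributes [w a b.-1], any other [w a b]. The total is [(#|X| - a - b) * w a b + b * w a b.-1],
   which [binV_pred] evaluates. *)
transitivity (\sum_(x <- X) ((x \in X)%:R * w #|` A i| #|` B i|
  - (x \in A i)%:R * w #|` A i| #|` B i|
  + (x \in B i)%:R * (w #|` A i| #|` B i|.-1 - w #|` A i| #|` B i|))).
  rewrite big_split /= sumrB -!mulr_suml !sum_mem_fset ?AX ?BX //.
  by rewrite mulrBr /w binV_pred ?noB0 // natrD; ring.
rewrite big_seq [RHS]big_seq; apply: eq_bigr => x xX; rewrite xX.
have := cardfsD1 x (B i); case: (boolP (x \in B i)) => xB e.
  have xA : (x \in A i) = false.
    by apply/negP => xA; have := in_fset0 x; rewrite -(AB i iS) in_fsetI xA xB.
  by rewrite e xA /=; ring.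
rewrite e; case: (x \in A i) => /=; ring.
Qed.

(** The injection is [phi]. A set missing [D] is kept: it contains [r] or avoids all of [r |: D].
    Any other set trades [f (first Q)] for [r], and so ends up containing [r]. *)
Lemma card_closed_draws_le (T : finType) (q : nat) (D : {set T}) (r : T)
    (f : T -> T) :
  r \notin D -> {in D, forall i, f i != i} ->
  (#|[set Q : {set T} | (#|Q| == q) && [forall i in Q :&: D, f i \in Q]]|
   <= #|[set Q : {set T} | (Q \subset ~: (r |: D)) && (#|Q| == q)]|
      + #|[set Q : {set T} | (#|Q| == q) && (r \in Q)]|)%N.
Proof.
move=> rD fD; set bad := [set Q | _].
pose is_first (Q : {set T}) v :=
  (v \in Q :&: D) && [forall u in Q :&: D, enum_rank v <= enum_rank u]%N.
pose first Q := odflt r [pick v | is_first Q v].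
have firstP Q : Q :&: D != set0 -> is_first Q (first Q).
  case/set0Pn=> v0 v0QD; rewrite /first; case: pickP => //= no_first.
  have [v vQD v_min] := arg_minnP enum_rank v0QD.
  have /negP[] := no_first v; rewrite /is_first [_ \in _]vQD.
  by apply/forall_inP => u /v_min.
have firstE Q v : is_first Q v -> first Q = v.
  move=> fv; rewrite /first; case: pickP => [w fw|/(_ v)]; last by rewrite fv.
  have /andP[vQD /forall_inP v_min] := fv.
  have /andP[wQD /forall_inP w_min] := fw.
  by apply/enum_rank_inj/ord_inj/anti_leq; rewrite w_min ?v_min.
pose swap Q := tperm (f (first Q)) r @: Q.
pose phi Q := if Q :&: D == set0 then Q else swap Q.
(* The swap keeps the first hit [v], which is neither [r] nor [f v]. It can bring only [f v] into
   [D], and then [f v] was already in [Q], hence not before [v]. So the image reveals [v], and with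
   it the transposition to undo. *)
have swapD Q : Q \in bad -> Q :&: D != set0 -> is_first (swap Q) (first Q).
  rewrite inE => /andP[_ /forall_inP Qcl] hit.
  have /andP[vQD /forall_inP v_min] := firstP Q hit.
  have [vQ vD] := setIP vQD; set v := first Q in vQD v_min vQ vD *.
  apply/andP; split.
    rewrite inE vD andbT; apply/imsetP; exists v => //.
    by rewrite tpermD ?fD //; apply: contraNneq rD => ->.
  apply/forall_inP => _ /setIP[/imsetP[u uQ ->]].
  case: tpermP => [_|_ fvD|_ _ uD]; first by rewrite (negPf rD).
    by apply: v_min; rewrite inE Qcl.
  by apply: v_min; rewrite inE uQ.
have phi_inj : {in bad &, injective phi}.
  (* The two branches of [phi] cannot collide: a swapped set still meets [D]. *)
  have mix Q Q' : Q \in bad -> Q :&: D != set0 -> Q' :&: D = set0 -> swap Q != Q'.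
    move=> Qb hit miss; apply/eqP => e.
    by have /andP[] := swapD _ Qb hit; rewrite e miss inE.
  move=> Q Q' Qb Q'b; rewrite /phi.
  case: eqP => [e|/eqP ne]; case: eqP => [e'|/eqP ne'] //.
  - by move/esym/eqP; rewrite (negPf (mix _ _ _ _ _)).
  - by move/eqP; rewrite (negPf (mix _ _ _ _ _)).
  move=> e; have e1 : first Q = first Q'.
    by rewrite -(firstE _ _ (swapD _ Qb ne)) e (firstE _ _ (swapD _ Q'b ne')).
  by move: e; rewrite /swap e1; apply/imset_inj/perm_inj.
rewrite -(card_in_imset phi_inj); apply: leq_trans (leq_card_setU _ _).
apply/subset_leq_card/subsetP => _ /imsetP[Q Qb ->]; rewrite /phi.
have := Qb; rewrite inE => /andP[Qq /forall_inP Qcl].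
case: (eqVneq (Q :&: D)) => [miss|hit]; rewrite !inE.
  rewrite Qq !andbT /=; have [|rQ] := boolP (r \in Q); first by rewrite orbT.
  rewrite orbF; apply/subsetP => x xQ; rewrite !inE negb_or.
  rewrite (contraNneq _ rQ) /= => [|<- //]; apply/negP => xD.
  by have := in_set0 x; rewrite -miss inE xQ xD.
have /andP[vQD _] := firstP Q hit.
rewrite card_imset ?Qq /=; last exact: perm_inj.
apply/orP; right; apply/imsetP; exists (f (first Q)); first exact: Qcl.
by rewrite tpermL.
Qed.

(** Each term of [bollobas_sum] is at least the inverse of the central binomial coefficient, as
    ['C(a + b, a) <= 'C(m, a) <= 'C(m, m./2)]. *)
Lemma bollobas_leq (U : choiceType) (I : finType) (m : nat) (S : {set I})
    (A B : I -> {fset U}) :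
  {in S, forall i, (A i `&` B i = fset0)%fset} ->
  {in S, forall i, (#|` A i| + #|` B i| <= m)%N} ->
  {in S &, forall i j, i != j -> (A i `&` B j)%fset != fset0} ->
  (#|S| <= 'C(m, m./2))%N.
Proof.
move=> AB ABm cross.
pose X := (\bigcup_(i <- enum S) (A i `|` B i))%fset.
have ABX i : i \in S -> (A i `<=` X)%fset && (B i `<=` X)%fset.
  by move=> iS; rewrite -fsubUset; apply: bigfcup_sup; rewrite ?mem_enum.
have sum_le1 : \sum_(i in S) ('C(#|` A i| + #|` B i|, #|` A i|)%:R)^-1 <= 1 :> rat.
  by apply: (@bollobas_sum _ _ _ X) => // i /ABX/andP[].
have c0 : 0 < 'C(m, m./2)%:R :> rat by rewrite ltr0n bin_gt0; lia.
rewrite -(ler_nat rat) -(ler_pM2l (x := 'C(m, m./2)%:R^-1)) ?invr_gt0 //.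
rewrite mulVf ?gt_eqF // mulr_natr; apply: le_trans sum_le1.
rewrite -sumr_const; apply: ler_sum => i iS.
rewrite lef_pV2 ?posrE // ?ler_nat; last by rewrite ltr0n bin_gt0 leq_addr.
exact: leq_trans (leq_bin2l _ (ABm i iS)) (leq_bin_half _ _).
Qed.

Theorem theorem6p1 (R : realType) (U : choiceType) (m n : nat)
    (A B : 'I_n -> {fset U})
    (hAB : forall i : 'I_n, (A i `&` B i = fset0)%fset)
    (hm : forall i : 'I_n, (#|` A i| + #|` B i| <= m)%N)
    (hn : ('C(m, m./2) < n)%N)
    (q : nat) (hq : (1 <= q <= n)%N) :
  let k := (n - 'C(m, m./2))%N in
  let bound : R :=
    1 - \prod_(0 <= i < k.+1) ((n%:R - q%:R - i%:R) / (n%:R - i%:R))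
      - q%:R / n%:R in
  unifPr R (qsubsets n q)
    (fun Q : {set 'I_n} =>
       [exists i in Q, exists j in ~: Q, (A i `&` B j `<=` B i)%fset])
    >= bound
  /\ bound >= 1 - expR (- (q%:R * (k%:R + 1) / n%:R)) - q%:R / n%:R.
Proof.
move=> k bound; have /andP[q1 qn] := hq.
have C0 : (0 < 'C(m, m./2))%N by rewrite bin_gt0; lia.
have kn : (k.+1 <= n)%N by rewrite /k; lia.
have n0 : 0 < n%:R :> R by rewrite ltr0n; lia.
split; last first.
  rewrite lerD2r lerD2l lerN2.
  (* If [n - q <= k], the factor at [i = n - q] is zero. Otherwise all factors are nonnegative and
     each is at most [1 - q / n], hence at most [exp (- q / n)]. *)
  have [nqk|nqk] := ltnP (n - q) k.+1.
    rewrite (big_cat_nat (leq0n _) (ltnW nqk)) /= (big_ltn nqk) natrB // subrr mul0r.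
    by rewrite mul0r mulr0 expR_ge0.
  have -> : - (q%:R * (k%:R + 1) / n%:R) = k.+1%:R * (- (q%:R / n%:R)) :> R.
    by rewrite -natr1; ring.
  rewrite expRM_natl -{2}[k.+1]subn0 -prodr_const_nat.
  rewrite big_nat [leRHS]big_nat; apply: ler_prod => i /andP[_ ik].
  have ni : 0 < n%:R - i%:R :> R by rewrite subr_gt0 ltr_nat; lia.
  apply/andP; split.
    by apply: divr_ge0 (ltW ni); rewrite -natrB // subr_ge0 ler_nat; lia.
  apply: le_trans (expR_ge1Dx _).
  rewrite addrAC mulrDl divff ?gt_eqF // lerD2l mulNr lerN2.
  by rewrite ler_pM2l ?ltr0n // lef_pV2 ?posrE // gerBl.
pose D0 := [set i | [exists j, (j != i) && (A i `&` B j == fset0)%fset]].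
have kD0 : (k <= #|D0|)%N.
  have : (#|~: D0| <= 'C(m, m./2))%N.
    apply: (bollobas_leq (A := A) (B := B)) => // i j; rewrite !inE => nDi _ ij.
    by apply: contraNneq nDi => e; apply/existsP; exists j; rewrite eq_sym ij e eqxx.
  by have := cardsC D0; rewrite card_ord /k; lia.
have [D] : exists D, D \in [set D : {set 'I_n} | D \subset D0 & #|D| == k].
  by apply/set0Pn; rewrite -card_gt0 cards_draws bin_gt0.
rewrite inE => /andP[/subsetP DD0 /eqP Dk].
(* The central binomial coefficient is positive, so [k < n] and a point is left over. *)
have [r] : exists r, r \in ~: D.
  by apply/set0Pn; rewrite -card_gt0; have := cardsC D; rewrite card_ord; lia.
rewrite inE => rD.
pose f i := odflt r [pick j | (j != i) && (A i `&` B j == fset0)%fset].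
have fP : {in D, forall i, f i != i /\ (A i `&` B (f i) = fset0)%fset}.
  move=> i /DD0; rewrite inE /f => /existsP[j0 j0P].
  by case: pickP => [j /andP[? /eqP]|/(_ j0)] //; rewrite j0P.
have := card_closed_draws_le q rD (fun i iD => (fP i iD).1).
set bad := [set Q | _]; rewrite cards_draws.
have -> : #|~: (r |: D)| = (n - k.+1)%N.
  by have := cardsC (r |: D); rewrite cardsU1 rD Dk card_ord; lia.
set with_r := [set Q : {set 'I_n} | _ & r \in Q]; set E := (fun Q : {set 'I_n} => _).
have Nqs : #|qsubsets n q| = 'C(n, q) by rewrite card_draws card_ord.
have with_rE : (#|with_r| + 'C(n - 1, q))%N = 'C(n, q).
  rewrite -Nqs -(cardsID [set Q : {set 'I_n} | r \in Q] (qsubsets n q)); congr (_ + _)%N.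
    by apply: eq_card => Q; rewrite !inE.
  have -> : (n - 1)%N = #|~: [set r]|.
    by have := cardsC [set r]; rewrite cards1 card_ord; lia.
  by rewrite -cards_draws; apply: eq_card => Q; rewrite !inE subsetC sub1set inE.
(* If the event fails at [Q], then [f i] lies in [Q] for every [i] in [Q :&: D], because [A i] and
   [B (f i)] are disjoint; so [Q] is in [bad]. *)
have goodbad : ('C(n, q) <= #|[set Q in qsubsets n q | E Q]| + #|bad|)%N.
  rewrite -Nqs; apply: leq_trans (leq_card_setU _ _).
  apply/subset_leq_card/subsetP => Q; rewrite !inE => Qq; rewrite Qq /=.
  rewrite -implyNb; apply/implyP => nE; apply/forall_inP => i /setIP[iQ iD].
  apply: contraNT nE => fQ; apply/exists_inP; exists i => //.
  apply/exists_inP; exists (f i); first by rewrite inE.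
  by rewrite (fP i iD).2 fsub0set.
move=> badle.
have Cq : 0 < 'C(n, q)%:R :> R by rewrite ltr0n bin_gt0.
rewrite /unifPr Nqs ler_pdivlMr // /bound !mulrBl mul1r (prodr_bin R q kn).
(* The case [j = 1] counts the sets missing [r], so [with_r] makes up the fraction [q / n] of all
   [q]-sets. *)
have := prodr_bin R q (n := n) (j := 1); rewrite big_nat1 !subr0 mulrBl divff ?gt_eqF //.
rewrite mulrBl mul1r.
move=> /(_ (leq_trans q1 qn)) e.
have : 'C(n, q)%:R <= #|[set Q in qsubsets n q | E Q]|%:R
    + ('C(n - k.+1, q)%:R + #|with_r|%:R) :> R.
  by rewrite -!natrD ler_nat; lia.
have : #|with_r|%:R + 'C(n - 1, q)%:R = 'C(n, q)%:R :> R by rewrite -natrD with_rE.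
lra.
Qed.
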